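(* Let $1\le t\le r$. Let $H$ be a random $r\times t$ complex matrix that is full rank with probability $1$, with $E\|H\|_F^2<\infty$ and $E|\log\det(H^*H)|<\infty$, and let $\hat H$ be any random variable jointly distributed with $H$ (including the no-CSIT case where $\hat H$ is independent of $H$). Fix a positive definite $r\times r$ matrix $\Sigma_Z$, a positive definite $t\times t$ matrix $\Sigma_X'$ with $\mathrm{tr}(\Sigma_X')\le 1$, and a positive semidefinite $t\times t$ matrix $\Sigma_S'$; for $P>0$ put $\Sigma_X=P\Sigma_X'$ and $\Sigma_S=P\Sigma_S'$. Define the no-interference upper bound \[ R_0(P)=E_H\log\frac{|\Sigma_Z+H\Sigma_XH^*|}{|\Sigma_Z|} \] and the achievable rate \[ R(P)=E_{\hat H}\Big( E_{H|\hat H}\log\big\{|\Sigma_X|\,|H(\Sigma_X+\Sigma_S)H^*+\Sigma_Z|\big\} - \inf_{W\in\mathbb{C}^{t\times t}} E_{H|\hat H}\log|M(W,H)|\Big), \] where \[ M(W,H)=\begin{pmatrix}\Sigma_X+W\Sigma_S W^* & (\Sigma_X+W\Sigma_S)H^*\\ H(\Sigma_X+\Sigma_S W^* ) & H(\Sigma_X+\Sigma_S)H^*+\Sigma_Z\end{pmatrix}. \] Then $\Delta R(P)=R_0(P)-R(P)\to 0$ as $P\to\infty$.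
   Context: The $t\times r$ fading dirty paper channel is $Y=H(X+S)+Z$, with $X\sim\mathcal{CN}(0,\Sigma_X)\in\mathbb{C}^t$ the transmitted signal, $S\sim\mathcal{CN}(0,\Sigma_S)$ interference known non-causally at the transmitter but not at the receiver, $Z\sim\mathcal{CN}(0,\Sigma_Z)\in\mathbb{C}^r$ noise, $X,S,Z$ independent; $H$ is known perfectly at the receiver and the transmitter only knows $\hat H$. $R(P)$ is the rate achieved by dirty paper coding with auxiliary random variable $U=X+WS$ ($W$ the $t\times t$ inflation factor, chosen as a function of $\hat H$), and $R_0(P)$ is the rate achievable with the same input covariance in the absence of interference. $|A|$ denotes determinant and $A^*$ conjugate transpose. *)

(* Defs.v *)
From HB Require Import structures.
From mathcomp Require Import all_boot all_order all_algebra.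
From mathcomp Require Import all_classical all_reals all_analysis.
From mathcomp Require Import complex.
Set Implicit Arguments. Unset Strict Implicit. Unset Printing Implicit Defensive.
Import Order.TTheory GRing.Theory Num.Theory.
Local Open Scope ring_scope.

Section Defs.
Variable R : realType.
Local Notation C := R[i].

Definition adjmx (m n : nat) (A : 'M[C]_(m, n)) : 'M[C]_(n, m) :=
  (map_mx Num.conj A)^T.

(* Hermitian positive semidefinite / positive definite matrices.
   In a numClosedFieldType, [0 <= z] means z is real and nonnegative. *)
Definition psdmx (n : nat) (A : 'M[C]_n) : Prop :=
  A = adjmx A /\ forall v : 'cV[C]_n, 0 <= (adjmx v *m A *m v) 0 0.
Definition pdmx (n : nat) (A : 'M[C]_n) : Prop :=
  A = adjmx A /\ forall v : 'cV[C]_n, v != 0 -> 0 < (adjmx v *m A *m v) 0 0.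

(* log-determinant of a matrix whose determinant is real (Hermitian matrices):
   natural log of the real part of the determinant *)
Definition logdet (n : nat) (A : 'M[C]_n) : R := ln (complex.Re (\det A)).

Definition frob2 (m n : nat) (A : 'M[C]_(m, n)) : R :=
  \sum_(i < m) \sum_(j < n) (complex.Re (A i j) ^+ 2 + complex.Im (A i j) ^+ 2).

(* the block covariance matrix M(W,H) of (U, Y), U = X + W S *)
Definition Mmx (t r : nat) (SX SS : 'M[C]_t) (SZ : 'M[C]_r)
    (W : 'M[C]_t) (H : 'M[C]_(r, t)) : 'M[C]_(t + r) :=
  block_mx (SX + W *m SS *m adjmx W) ((SX + W *m SS) *m adjmx H)
           (H *m (SX + SS *m adjmx W)) (H *m (SX + SS) *m adjmx H + SZ).
End Defs.

(* Main.v *)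
Require Import Defs.
From HB Require Import structures.
From mathcomp Require Import all_boot all_order all_algebra.
From mathcomp Require Import all_classical all_reals all_analysis.
From mathcomp Require Import complex.
From mathcomp Require Import spectral sesquilinear measurable_realfun ring lra.
Set Implicit Arguments. Unset Strict Implicit. Unset Printing Implicit Defensive.
Import Order.TTheory GRing.Theory Num.Theory.
Import numFieldNormedType.Exports.
Local Open Scope ring_scope.
Local Open Scope classical_set_scope.

(* Write X, S, Z for the covariances and G = H^* Z^-1 H.  For every inflation
   factor W, the Schur complement of M(W,H) is the error covariance of a linear
   estimate of x from H x + Z plus a positive semidefinite term, so
   |M(W,H)| |Z + H X H^*| >= |X| |Z| |H(X+S)H^* + Z|: no W beats the capacity
   without interference.  At W = 1 the matrix M factors and
   |M(1,H)| = |X+S| |Z|.  Hence the loss lies between 0 and the mean of the loss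
   of W = 1, which by Sylvester's identity equals
   log |1/P + X G| / |X G| - log |1/P + (X+S) G| / |(X+S) G|
   with X, S normalised to P = 1.  It tends to 0 as P grows, and for P >= 1 it is
   at most tr (X G) - log |X G|, which the moment hypotheses make integrable. *)

(** * Positive semidefinite matrices *)

Lemma adjmxK {R : realType} m n (A : 'M[R[i]]_(m, n)) : adjmx (adjmx A) = A.
Proof. by apply/matrixP => i j; rewrite !mxE conjCK. Qed.

Lemma adjmxM {R : realType} m n p (A : 'M[R[i]]_(m, n)) (B : 'M[R[i]]_(n, p)) :
  adjmx (A *m B) = adjmx B *m adjmx A.
Proof. by rewrite /adjmx map_mxM trmx_mul. Qed.

Lemma adjmxD {R : realType} m n (A B : 'M[R[i]]_(m, n)) :
  adjmx (A + B) = adjmx A + adjmx B.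
Proof. by rewrite /adjmx map_mxD linearD. Qed.

Lemma adjmxB {R : realType} m n (A B : 'M[R[i]]_(m, n)) :
  adjmx (A - B) = adjmx A - adjmx B.
Proof. by rewrite /adjmx map_mxB linearB. Qed.

Lemma adjmx1 {R : realType} n : adjmx (1%:M : 'M[R[i]]_n) = 1%:M.
Proof. by rewrite /adjmx map_mx1 trmx1. Qed.

Lemma conj_realC {R : realType} (s : R) : Num.conj (s%:C)%C = (s%:C)%C.
Proof. by apply/CrealP/complex_realP; exists s. Qed.

Lemma adjmxZr {R : realType} m n (s : R) (A : 'M[R[i]]_(m, n)) :
  adjmx ((s%:C)%C *: A) = (s%:C)%C *: adjmx A.
Proof. by apply/matrixP => i j; rewrite !mxE rmorphM /= conj_realC. Qed.

Lemma det_adjmx {R : realType} n (A : 'M[R[i]]_n) :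
  \det (adjmx A) = Num.conj (\det A).
Proof. by rewrite /adjmx det_tr det_map_mx. Qed.

Lemma adjmx_gram_ge0 {R : realType} n (v : 'cV[R[i]]_n) :
  0 <= (adjmx v *m v) 0 0.
Proof.
by rewrite mxE sumr_ge0 // => i _; rewrite !mxE mulrC mul_conjC_ge0.
Qed.

Lemma psdmx_congr {R : realType} m n (A : 'M[R[i]]_n) (B : 'M[R[i]]_(m, n)) :
  psdmx A -> psdmx (B *m A *m adjmx B).
Proof.
move=> [hA pA]; split; first by rewrite !adjmxM adjmxK -hA mulmxA.
by move=> v; move: (pA (adjmx B *m v)); rewrite adjmxM adjmxK !mulmxA.
Qed.

Lemma psdmxD {R : realType} n (A B : 'M[R[i]]_n) :
  psdmx A -> psdmx B -> psdmx (A + B).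
Proof.
move=> [hA pA] [hB pB]; split; first by rewrite adjmxD -hA -hB.
by move=> v; rewrite mulmxDr mulmxDl mxE addr_ge0.
Qed.

Lemma psdmx1 {R : realType} n : psdmx (1%:M : 'M[R[i]]_n).
Proof. by split=> [|v]; rewrite ?adjmx1 // mulmx1 adjmx_gram_ge0. Qed.

Lemma psdmx_gram {R : realType} m n (B : 'M[R[i]]_(m, n)) :
  psdmx (B *m adjmx B).
Proof. by rewrite -[X in X *m _]mulmx1; apply/psdmx_congr/psdmx1. Qed.

Lemma psdmxZ {R : realType} n (s : R) (A : 'M[R[i]]_n) :
  0 <= s -> psdmx A -> psdmx ((s%:C)%C *: A).
Proof.
move=> s0 [hA pA]; split; first by rewrite adjmxZr -hA.
by move=> v; rewrite -scalemxAr -scalemxAl mxE mulr_ge0 // ler0c.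
Qed.

Lemma pdmx_psd {R : realType} n (A : 'M[R[i]]_n) : pdmx A -> psdmx A.
Proof.
move=> [hA pA]; split=> // v; have [->|/pA/ltW//] := eqVneq v 0.
by rewrite mulmx0 mxE.
Qed.

Lemma pdmx_unit {R : realType} n (A : 'M[R[i]]_n) : pdmx A -> A \in unitmx.
Proof.
move=> [_ pA]; rewrite -unitmx_tr -row_free_unit -kermx_eq0.
apply/negPn/negP => /rowV0Pn[u /sub_kermxP uA u0].
have := pA u^T; rewrite trmx_eq0 => /(_ u0).
by rewrite -mulmxA -[A]trmxK -trmx_mul uA trmx0 mulmx0 mxE ltxx.
Qed.

Lemma psdmx_spectral {R : realType} n (A : 'M[R[i]]_n) : psdmx A ->
  exists (U : 'M[R[i]]_n) (d : 'I_n -> R),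
    [/\ adjmx U *m U = 1%:M, forall j, 0 <= d j &
        A = adjmx U *m diag_mx (\row_j (d j)%:C%C) *m U].
Proof.
move=> [hA pA].
have adjE m p (B : 'M[R[i]]_(m, p)) : map_mx Num.conj B^T = adjmx B.
  by rewrite /adjmx map_trmx.
have Ah : A \is hermsymmx.
  by apply/is_hermitianmxP; rewrite expr0 scale1r adjE.
have /orthomx_spectralP AE := hermitian_normalmx Ah.
have Uu := spectral_unitarymx A.
have Du := spectral_unit A.
set U := spectralmx A in AE Uu Du.
have UU : U *m adjmx U = 1%:M by move/unitarymxP: Uu; rewrite adjE.
rewrite invmx_unitary // adjE in AE.
set D := spectral_diag A in AE.
(* The [j]-th eigenvalue is the quadratic form of [A] at the eigenvector [U^* e_j], hence real and
   nonnegative. *)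
have dE j : (adjmx (adjmx U *m delta_mx j (0 : 'I_1)) *m A *m
    (adjmx U *m delta_mx j (0 : 'I_1))) 0 0 = D 0 j.
  have -> : adjmx (adjmx U *m delta_mx j (0 : 'I_1)) = delta_mx 0 j *m U.
    rewrite adjmxM adjmxK; congr (_ *m _); apply/matrixP => a b.
    by rewrite !mxE rmorph_nat andbC.
  rewrite AE !mulmxA -[_ *m U *m adjmx U]mulmxA UU mulmx1.
  rewrite -[_ *m U *m adjmx U]mulmxA UU mulmx1 -rowE row_diag_mx -scalemxAl.
  by rewrite mul_delta_mx !mxE !eqxx mulr1.
have D0 j : 0 <= D 0 j by rewrite -dE.
exists U, (fun j => complex.Re (D 0 j)); split.
- exact: mulmx1C.
- by move=> j; have := D0 j; rewrite lecE /= => /andP[].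
- rewrite {1}AE; congr (_ *m diag_mx _ *m _); apply/rowP => j; rewrite mxE.
  by rewrite RRe_real // realE D0.
Qed.

(** One family [d] of eigenvalues serves all [a] and [s]: [a = 0], [s = 1] gives the determinant of
    [A], and [a = 1], [s = p] lets the power vary with [d] fixed. *)
Lemma det_scalarD_psd {R : realType} n (A : 'M[R[i]]_n) : psdmx A ->
  exists d : 'I_n -> R, [/\ forall j, 0 <= d j,
    \tr A = ((\sum_j d j)%:C)%C &
    forall a s : R, \det (((a%:C)%C)%:M + (s%:C)%C *: A) =
      ((\prod_j (a + s * d j))%:C)%C].
Proof.
move=> /psdmx_spectral [U [d [UU d0 ->]]]; exists d.
have UU' : U *m adjmx U = 1%:M by exact: mulmx1C.
split=> // [|a s].
  rewrite -mulmxA mxtrace_mulC -mulmxA UU' mulmx1 mxtrace_diag rmorph_sum.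
  by apply: eq_bigr => j _; rewrite mxE.
have -> : ((a%:C)%C)%:M + (s%:C)%C *: (adjmx U *m diag_mx (\row_j (d j)%:C%C) *m U) =
    adjmx U *m diag_mx (\row_j (a + s * d j)%:C%C) *m U.
  have -> : diag_mx (\row_j (a + s * d j)%:C%C) = 
     ((a%:C)%C)%:M + (s%:C)%C *: diag_mx (\row_j (d j)%:C%C).
    apply/matrixP => i j; rewrite !mxE.
    by case: eqP => [->|]; rewrite ?mulr1n ?mulr0n ?mulr0 ?addr0 // rmorphD rmorphM.
  by rewrite mulmxDr mulmxDl mul_mx_scalar -scalemxAl UU -scalemxAr -scalemxAl scalemx1.
rewrite !det_mulmx mulrC mulrA -det_mulmx UU' det1 mul1r det_diag rmorph_prod.
by apply: eq_bigr => j _; rewrite mxE.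
Qed.

Lemma psdmx_sqrt {R : realType} n (A : 'M[R[i]]_n) : psdmx A ->
  exists B : 'M[R[i]]_n, A = B *m adjmx B.
Proof.
move=> /psdmx_spectral [U [d [UU d0 ->]]].
exists (adjmx U *m diag_mx (\row_j (Num.sqrt (d j))%:C%C)).
rewrite adjmxM adjmxK mulmxA; congr (_ *m _); rewrite -mulmxA; congr (_ *m _).
have -> : adjmx (diag_mx (\row_j ((Num.sqrt (d j))%:C)%C)) =
    diag_mx (\row_j ((Num.sqrt (d j))%:C)%C) :> 'M[R[i]]_n.
  apply/matrixP => i j; rewrite !mxE eq_sym; case: eqP => [->|_].
    by rewrite !mulr1n conj_realC.
  by rewrite !mulr0n rmorph0.
rewrite mulmx_diag; congr diag_mx; apply/rowP => j; rewrite !mxE -rmorphM /=.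
by rewrite -expr2 sqr_sqrtr.
Qed.

Lemma pdmx_sqrt {R : realType} n (A : 'M[R[i]]_n) : pdmx A ->
  exists2 B : 'M[R[i]]_n, B \in unitmx & A = B *m adjmx B.
Proof.
move=> pA; have [B AE] := psdmx_sqrt (pdmx_psd pA); exists B => //.
by have := pdmx_unit pA; rewrite AE unitmx_mul => /andP[].
Qed.

Lemma det_psd_ge0 {R : realType} n (A : 'M[R[i]]_n) : psdmx A -> 0 <= \det A.
Proof.
move=> /psdmx_sqrt [B ->]; rewrite det_mulmx det_adjmx; exact: mul_conjC_ge0.
Qed.

Lemma det_pd_gt0 {R : realType} n (A : 'M[R[i]]_n) : pdmx A -> 0 < \det A.
Proof.
move=> pA; rewrite lt0r (det_psd_ge0 (pdmx_psd pA)) andbT.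
by have := pdmx_unit pA; rewrite unitmxE unitfE.
Qed.

Lemma adjmx_gram_gt0 {R : realType} n (v : 'cV[R[i]]_n) :
  v != 0 -> 0 < (adjmx v *m v) 0 0.
Proof.
move=> v0; rewrite lt0r adjmx_gram_ge0 andbT; apply: contra v0.
rewrite mxE psumr_eq0 => [/allP w0|i _]; last first.
  by rewrite !mxE mulrC mul_conjC_ge0.
apply/eqP/matrixP => i j; rewrite ord1 [RHS]mxE.
have := w0 i; rewrite mem_index_enum => /(_ isT); rewrite !mxE mulrC /=.
by rewrite mul_conjC_eq0 => /eqP.
Qed.

Lemma psdmx_unit_pd {R : realType} n (A : 'M[R[i]]_n) :
  psdmx A -> A \in unitmx -> pdmx A.
Proof.
move=> [hA pA] uA; split=> // v v0.
have [B AE] := psdmx_sqrt (conj hA pA).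
have uB : adjmx B \in unitmx by move: uA; rewrite AE unitmx_mul => /andP[].
rewrite AE mulmxA -mulmxA -{1}[B]adjmxK -adjmxM; apply: adjmx_gram_gt0.
by apply: contra v0 => /eqP w0; rewrite -[v](mulKmx uB) w0 mulmx0.
Qed.

Lemma det_psdD_ge {R : realType} n (A B : 'M[R[i]]_n) :
  psdmx A -> psdmx B -> \det A <= \det (A + B).
Proof.
move=> psA psB; have [uA|nuA] := boolP (A \in unitmx); last first.
  move: nuA; rewrite unitmxE unitfE negbK => /eqP ->.
  exact/det_psd_ge0/psdmxD.
have [E EE uE] := pdmx_sqrt (psdmx_unit_pd psA uA).
set F := invmx E; have -> : A + B = E *m (1%:M + F *m B *m adjmx F) *m adjmx E.
  rewrite mulmxDr mulmxDl mulmx1 -uE !mulmxA mulmxV // mul1mx -mulmxA -adjmxM.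
  by rewrite mulmxV // adjmx1 mulmx1.
have [d [d0 _ dE]] := det_scalarD_psd (psdmx_congr F psB).
have := dE 1 1; rewrite !rmorph1 scale1r uE !det_mulmx => ->.
rewrite mulrAC ler_peMr //; first by rewrite det_adjmx mul_conjC_ge0.
rewrite -[1](rmorph1 (real_complex R)) lecR.
by elim/big_ind: _ => // [x y|j _]; [exact: mulr_ege1 | rewrite mul1r lerDl].
Qed.

(** The trace is at least every eigenvalue, so the difference is the Gram matrix of
    [U^* diag (sqrt (s - d_j))]. *)
Lemma psdmx_tr_scalar {R : realType} n (A : 'M[R[i]]_n) :
  psdmx A -> psdmx ((\tr A)%:M - A).
Proof.
move=> /psdmx_spectral [U [d [UU d0 AE]]].
have UU' : U *m adjmx U = 1%:M by exact: mulmx1C.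
have tE : \tr A = ((\sum_j d j)%:C)%C.
  rewrite AE -mulmxA mxtrace_mulC -mulmxA UU' mulmx1 mxtrace_diag rmorph_sum.
  by apply: eq_bigr => j _; rewrite mxE.
set s := \sum_j d j in tE.
pose e j := Num.sqrt (s - d j).
pose D : 'M[R[i]]_n := diag_mx (\row_j (e j)%:C%C).
have -> : (\tr A)%:M - A = (adjmx U *m D) *m adjmx (adjmx U *m D).
  have -> : adjmx (adjmx U *m D) = D *m U.
    rewrite adjmxM adjmxK; congr (_ *m _); apply/matrixP => i j.
    rewrite !mxE eq_sym; case: eqP => [->|_]; last by rewrite !mulr0n rmorph0.
    by rewrite !mulr1n conj_realC.
  rewrite -mulmxA (mulmxA D) mulmx_diag tE.
  have -> : diag_mx (\row_j ((\row_j0 (e j0)%:C%C) 0 j * (\row_j0 (e j0)%:C%C) 0 j)) =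
      ((s%:C)%C)%:M - diag_mx (\row_j (d j)%:C%C) :> 'M[R[i]]_n.
    apply/matrixP => i j; rewrite !mxE.
    case: eqP => [->|_]; last by rewrite !mulr0n subr0.
    rewrite !mulr1n -rmorphM /= -expr2 sqr_sqrtr ?rmorphB // subr_ge0.
    by rewrite /s (bigD1 j) //= lerDl sumr_ge0.
  by rewrite mulmxA mulmxBr mulmxBl mul_mx_scalar -scalemxAl UU scalemx1 -AE.
exact: psdmx_gram.
Qed.

Lemma mxtrace_gram {R : realType} m n (A : 'M[R[i]]_(m, n)) :
  \tr (A *m adjmx A) = ((frob2 A)%:C)%C.
Proof.
rewrite /frob2 rmorph_sum; apply: eq_bigr => i _; rewrite mxE rmorph_sum.
by apply: eq_bigr => j _; rewrite !mxE /= -normCK -add_Re2_Im2.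
Qed.

Lemma mxtrace_psd_ge0 {R : realType} n (A : 'M[R[i]]_n) : psdmx A -> 0 <= \tr A.
Proof.
move=> /det_scalarD_psd [d [d0 -> _]].
by rewrite -(rmorph0 (real_complex R)) lecR sumr_ge0.
Qed.

Lemma frob2_ge0 {R : realType} m n (A : 'M[R[i]]_(m, n)) : 0 <= frob2 A.
Proof. by apply: sumr_ge0 => i _; apply: sumr_ge0 => j _; rewrite addr_ge0 ?sqr_ge0. Qed.

Lemma frob2M {R : realType} m n p (A : 'M[R[i]]_(m, n)) (B : 'M[R[i]]_(n, p)) :
  frob2 (A *m B) <= frob2 A * frob2 B.
Proof.
rewrite -lecR -mxtrace_gram rmorphM /= -!mxtrace_gram adjmxM.
have /(psdmx_congr A) /mxtrace_psd_ge0 := psdmx_tr_scalar (psdmx_gram B).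
rewrite mulmxBr mulmxBl raddfB /= subr_ge0 !mulmxA mul_mx_scalar -scalemxAl.
by rewrite mxtraceZ mulrC.
Qed.

(** * The determinant of M(W,H) *)

Lemma addmxE (V : zmodType) m n (A B : 'M[V]_(m, n)) i j :
  (A + B) i j = A i j + B i j.
Proof. by rewrite mxE. Qed.

Lemma oppmxE (V : zmodType) m n (A : 'M[V]_(m, n)) i j : (- A) i j = - A i j.
Proof. by rewrite mxE. Qed.

(** Matrix products do not commute, so [ring] cannot treat them directly. Once everything is
    expanded and left-associated, each product is an atom and the identity is linear in its
    entries. *)
Ltac entrywise_ring :=
  let i := fresh "i" in let j := fresh "j" in
  apply/matrixP => i j; rewrite !(addmxE, oppmxE);
  repeat match goal with |- context [fun_of_matrix (mulmx ?A ?B) i j] =>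
    move: (fun_of_matrix (mulmx A B) i j) => ?
  end;
  ring.

Lemma det_block_schur (F : fieldType) m n (A : 'M[F]_m) (B : 'M[F]_(m, n))
    (C : 'M[F]_(n, m)) (D : 'M[F]_n) : D \in unitmx ->
  \det (block_mx A B C D) = \det (A - B *m invmx D *m C) * \det D.
Proof.
move=> uD.
have -> : block_mx A B C D =
    block_mx 1%:M (B *m invmx D) 0 1%:M *m block_mx (A - B *m invmx D *m C) 0 C D.
  by rewrite mulmx_block !mul1mx !mul0mx !add0r subrK mulmxKV.
by rewrite det_mulmx det_ublock det_lblock !det1 !mul1r.
Qed.

(** Here and in the next two identities the primed matrices stand for adjoints; as free variables
    they make the identities purely algebraic. *)
Lemma mse_expand (F : comNzRingType) t r (X : 'M[F]_t) (Z : 'M[F]_r)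
    (H : 'M[F]_(r, t)) (K : 'M[F]_(t, r)) (H' : 'M[F]_(t, r)) (K' : 'M[F]_(r, t)) :
  (1%:M - K *m H) *m X *m (1%:M - H' *m K') + K *m Z *m K' =
  X - K *m (H *m X) - X *m H' *m K' + K *m (H *m X *m H' + Z) *m K'.
Proof.
rewrite !(mulmxBl, mulmxBr, mulmxDl, mulmxDr, mulNmx, mulmxN) !mul1mx !mulmx1.
rewrite !mulmxA ?mulNmx.
by entrywise_ring.
Qed.

(** [K0] solves the normal equations, so the terms linear in [K - K0] cancel and only the quadratic
    one remains. *)
Lemma complete_square (F : comNzRingType) t r (X : 'M[F]_t) (N : 'M[F]_r)
    (B K K0 : 'M[F]_(t, r)) (B' K' K0' : 'M[F]_(r, t)) :
  K0 *m N = B -> N *m K0' = B' ->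
  X - K *m B' - B *m K' + K *m N *m K' =
  X - K0 *m B' - B *m K0' + K0 *m N *m K0' + (K - K0) *m N *m (K' - K0').
Proof.
move=> <- <-; rewrite !(mulmxBl, mulmxBr) !mulmxA ?mulNmx.
by entrywise_ring.
Qed.

(** With [u = x + W s] and [y = H (x + s) + z], the residual [u - K y] splits into the independent
    parts [x - K (H x + z)] and [(W - K H) s]. When [K] is the optimal gain for [u], the Schur
    complement on the left is the covariance of this residual. *)
Lemma schur_expand (F : comNzRingType) t r (X S W W' : 'M[F]_t) (Z : 'M[F]_r)
    (H : 'M[F]_(r, t)) (K : 'M[F]_(t, r)) (H' : 'M[F]_(t, r)) (K' : 'M[F]_(r, t)) :
  K *m (H *m (X + S) *m H' + Z) = (X + W *m S) *m H' ->
  X + W *m S *m W' - K *m (H *m (X + S *m W')) =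
  X - K *m (H *m X) - X *m H' *m K' + K *m (H *m X *m H' + Z) *m K' +
  (W - K *m H) *m S *m (W' - H' *m K').
Proof.
(* The hypothesis enters multiplied by [K'], through a zero added as the difference of its two
   sides. *)
move=> /(congr1 (mulmx^~ K')) KD; rewrite -[LHS]addr0 -(subrr ((X + W *m S) *m H' *m K')).
rewrite -{1}KD !(mulmxBl, mulmxBr, mulmxDl, mulmxDr, mulNmx) !mulmxA ?mulNmx.
by entrywise_ring.
Qed.

(** At [W = 1], [u = x + s] and [y = H u + z]; subtracting [H] times the rows of [u] from those of
    [y] leaves a block triangular matrix. *)
Lemma det_Mmx1 {R : realType} t r (X S : 'M[R[i]]_t) (Z : 'M[R[i]]_r)
    (H : 'M[R[i]]_(r, t)) :
  \det (Mmx X S Z 1%:M H) = \det (X + S) * \det Z.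
Proof.
have -> : Mmx X S Z 1%:M H = block_mx 1%:M 0 H 1%:M *m
    block_mx (X + S) ((X + S) *m adjmx H) 0 Z.
  rewrite mulmx_block !mul1mx !mul0mx !addr0 /Mmx adjmx1 !mul1mx !mulmx1.
  by rewrite mulmxA.
by rewrite det_mulmx det_ublock det_lblock !det1 !mul1r.
Qed.

Lemma pdmx_congrD {R : realType} t r (X : 'M[R[i]]_t) (Z : 'M[R[i]]_r)
    (H : 'M[R[i]]_(r, t)) : psdmx X -> pdmx Z -> pdmx (H *m X *m adjmx H + Z).
Proof.
move=> /(psdmx_congr H) [hA pA] [hZ pZ]; split.
  by rewrite adjmxD -hA -hZ.
move=> v v0; rewrite mulmxDr mulmxDl mxE ltr_wpDl ?pZ //.
Qed.

(* Error covariance of the linear estimate K (H x + z) of x, when x and z have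
   covariances X and Z. *)
Definition mse {R : realType} t r (X : 'M[R[i]]_t) (Z : 'M[R[i]]_r)
    (H : 'M[R[i]]_(r, t)) (K : 'M[R[i]]_(t, r)) : 'M[R[i]]_t :=
  (1%:M - K *m H) *m X *m adjmx (1%:M - K *m H) + K *m Z *m adjmx K.

Lemma mseE {R : realType} t r (X : 'M[R[i]]_t) (Z : 'M[R[i]]_r)
    (H : 'M[R[i]]_(r, t)) (K : 'M[R[i]]_(t, r)) :
  mse X Z H K = X - K *m (H *m X) - X *m adjmx H *m adjmx K
     + K *m (H *m X *m adjmx H + Z) *m adjmx K.
Proof. by rewrite /mse adjmxB adjmx1 adjmxM mse_expand. Qed.

Lemma psdmx_mse {R : realType} t r (X : 'M[R[i]]_t) (Z : 'M[R[i]]_r)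
    (H : 'M[R[i]]_(r, t)) (K : 'M[R[i]]_(t, r)) :
  psdmx X -> psdmx Z -> psdmx (mse X Z H K).
Proof. by move=> pX pZ; apply: psdmxD; exact: psdmx_congr. Qed.

(** The Wiener filter: the gain of the linear minimum mean square error estimate of [x] from
    [H x + z]. *)
Definition mmse_gain {R : realType} t r (X : 'M[R[i]]_t) (Z : 'M[R[i]]_r)
    (H : 'M[R[i]]_(r, t)) : 'M[R[i]]_(t, r) :=
  X *m adjmx H *m invmx (H *m X *m adjmx H + Z).

(** For [S = 0] and [W = 1], [Mmx] is the joint covariance of [x] and [H x + z]. Its Schur
    complement is the minimal error covariance, and [det_Mmx1] evaluates its determinant. *)
Lemma det_mmse {R : realType} t r (X : 'M[R[i]]_t) (Z : 'M[R[i]]_r)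
    (H : 'M[R[i]]_(r, t)) : psdmx X -> pdmx Z ->
  \det (mse X Z H (mmse_gain X Z H)) * \det (H *m X *m adjmx H + Z) =
  \det X * \det Z.
Proof.
move=> pX pZ; have /pdmx_unit uN := pdmx_congrD H pX pZ.
have := det_Mmx1 X 0 Z H; rewrite /Mmx !mulmx0 !mul0mx !addr0 => <-.
rewrite (det_block_schur _ _ _ uN) mseE /mmse_gain (mulmxKV uN) addrNK.
by rewrite mulmxA.
Qed.

Lemma mse_mmse_gain {R : realType} t r (X : 'M[R[i]]_t) (Z : 'M[R[i]]_r)
    (H : 'M[R[i]]_(r, t)) (K : 'M[R[i]]_(t, r)) : psdmx X -> pdmx Z ->
  exists2 E, psdmx E & mse X Z H K = mse X Z H (mmse_gain X Z H) + E.
Proof.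
move=> pX pZ; have pN := pdmx_congrD H pX pZ; have uN := pdmx_unit pN.
have [hX _] := pX; have [hN _] := pN.
set N := H *m X *m adjmx H + Z in uN pN hN *; set K0 := mmse_gain X Z H.
exists ((K - K0) *m N *m adjmx (K - K0)); first exact/psdmx_congr/pdmx_psd.
have K0N : K0 *m N = X *m adjmx H by rewrite mulmxKV.
have NK0 : N *m adjmx K0 = H *m X.
  by rewrite {1}hN -adjmxM K0N adjmxM adjmxK -hX.
by rewrite !mseE -/N adjmxB; exact: complete_square.
Qed.

(** The Schur complement of [Mmx] exceeds the minimal error covariance by two positive semidefinite
    terms, one for the suboptimal gain and one for the residual interference; the determinant is
    monotone. *)
Lemma det_Mmx_ge {R : realType} t r (X S W : 'M[R[i]]_t) (Z : 'M[R[i]]_r)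
    (H : 'M[R[i]]_(r, t)) : psdmx X -> psdmx S -> pdmx Z ->
  \det X * \det Z * \det (H *m (X + S) *m adjmx H + Z) <=
  \det (Mmx X S Z W H) * \det (H *m X *m adjmx H + Z).
Proof.
move=> pX pS pZ; have pD := pdmx_congrD H (psdmxD pX pS) pZ.
have uD := pdmx_unit pD; have pN := pdmx_congrD H pX pZ.
have [hX _] := pX; have [hS _] := pS; have [hD _] := pD.
set D := H *m (X + S) *m adjmx H + Z in pD uD hD *.
rewrite -(det_mmse H pX pZ) /Mmx -/D (det_block_schur _ _ _ uD).
set K := _ *m invmx D; set N := H *m X *m adjmx H + Z.
have KD : K *m D = (X + W *m S) *m adjmx H by rewrite mulmxKV.
clearbody K.
have -> : X + W *m S *m adjmx W - K *m (H *m (X + S *m adjmx W)) =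
    mse X Z H K + (W - K *m H) *m S *m adjmx (W - K *m H).
  by rewrite mseE adjmxB adjmxM; exact: schur_expand.
have [E pE ->] := mse_mmse_gain H K pX pZ.
rewrite [leLHS]mulrAC; apply: ler_wpM2r; first exact: det_psd_ge0 (pdmx_psd pN).
apply: ler_wpM2r; first exact: det_psd_ge0 (pdmx_psd pD).
rewrite -addrA; apply: det_psdD_ge; first exact/psdmx_mse/pdmx_psd.
exact/psdmxD/psdmx_congr.
Qed.

(** * High-power expansion of the loss *)

(** Sylvester's identity: both sides are the determinant of the block matrix with identity diagonal
    blocks and off-diagonal blocks [- A] and [B]. *)
Lemma det1D_mulC (F : fieldType) m n (A : 'M[F]_(m, n)) (B : 'M[F]_(n, m)) :
  \det (1%:M + A *m B) = \det (1%:M + B *m A).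
Proof.
have := det_block_schur 1%:M (- A) B (unitmx1 F n).
rewrite det1 mulr1 invmx1 mulmx1 mulNmx opprK => <-.
have -> : block_mx 1%:M (- A) B 1%:M =
    block_mx 1%:M 0 B 1%:M *m block_mx 1%:M (- A) 0 (1%:M + B *m A).
  by rewrite mulmx_block !mul1mx !mul0mx !addr0 mulmx1 mulmxN addrC addrK.
by rewrite det_mulmx det_lblock det_ublock !det1 !mul1r.
Qed.

Lemma invmx_gram {R : realType} n (E : 'M[R[i]]_n) : E \in unitmx ->
  invmx (E *m adjmx E) = adjmx (invmx E) *m invmx E.
Proof.
move=> uE; have uA : adjmx E \in unitmx.
  by rewrite unitmxE det_adjmx unitfE conjC_eq0 -unitfE -unitmxE.
have EE : E *m adjmx E *m (adjmx (invmx E) *m invmx E) = 1%:M.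
  rewrite mulmxA -[E *m adjmx E *m _]mulmxA -adjmxM mulVmx // adjmx1 mulmx1.
  exact: mulmxV.
have uEE : E *m adjmx E \in unitmx by rewrite unitmx_mul uE.
by rewrite -[RHS](mulKmx uEE) EE mulmx1.
Qed.

(** With [X = L L^*] and [Z = E E^*], [d] lists the eigenvalues of [F^* F] for the whitened channel
    [F = E^-1 H L]. They do not depend on the power [p], and [c] does not depend on [H]. *)
Lemma det_signal_spectrum {R : realType} t r (X : 'M[R[i]]_t) (Z : 'M[R[i]]_r) :
  pdmx X -> pdmx Z -> exists2 c : R, 0 <= c & forall H : 'M[R[i]]_(r, t),
  exists d : 'I_t -> R, [/\ forall j, 0 <= d j,
    \sum_j d j <= c * frob2 H,
    ((\prod_j d j)%:C)%C = \det X * \det (adjmx H *m invmx Z *m H) &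
    forall p : R, \det (H *m ((p%:C)%C *: X) *m adjmx H + Z) =
      \det Z * ((\prod_j (1 + p * d j))%:C)%C].
Proof.
move=> /pdmx_sqrt [L uL ->] /pdmx_sqrt [E uE ->].
exists (frob2 (invmx E) * frob2 L); first by rewrite mulr_ge0 ?frob2_ge0.
move=> H; set F := invmx E *m H *m L.
have := psdmx_gram (adjmx F); rewrite adjmxK => /det_scalarD_psd [d [d0 trd detd]].
have EF : E *m F = H *m L by rewrite /F -mulmxA mulKVmx.
exists d; split=> //.
- rewrite -lecR -trd mxtrace_mulC mxtrace_gram lecR mulrAC.
  apply: le_trans (frob2M _ _) _.
  by rewrite ler_wpM2r ?frob2_ge0 ?frob2M.
- have := detd 0 1; rewrite rmorph1 scale1r rmorph0 add0r.
  under [in RHS]eq_bigr do rewrite add0r mul1r.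
  have -> : adjmx F *m F =
      adjmx L *m (adjmx H *m invmx (E *m adjmx E) *m H) *m L.
    by rewrite invmx_gram // !adjmxM !mulmxA.
  by move=> <-; rewrite !det_mulmx mulrC mulrA.
- clearbody F; move=> p; have := detd 1 p; rewrite rmorph1 => <-.
  (* Sylvester's identity passes from the [t x t] matrix [F^* F] to the [r x r] matrix [F F^*]. *)
  rewrite [in RHS]scalemxAr -det1D_mulC -scalemxAl.
  have -> : H *m ((p%:C)%C *: (L *m adjmx L)) *m adjmx H + E *m adjmx E =
    E *m (1%:M + (p%:C)%C *: (F *m adjmx F)) *m adjmx E.
    rewrite mulmxDr mulmxDl mulmx1 addrC -!scalemxAr -!scalemxAl; congr (_ + _ *: _).
    by rewrite !mulmxA EF -[_ *m adjmx F *m _]mulmxA -adjmxM EF adjmxM !mulmxA.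
  by rewrite !det_mulmx mulrAC.
Qed.

(** [Z] is at most its trace, hence [H^* H] is at most [tr Z] times [H^* Z^-1 H]. This bounds the
    log-determinant of [H^* Z^-1 H] below by the one in the moment hypothesis. *)
Lemma det_gram_le {R : realType} t r (Z : 'M[R[i]]_r) (H : 'M[R[i]]_(r, t)) :
  pdmx Z ->
  \det (adjmx H *m H) <= \tr Z ^+ t * \det (adjmx H *m invmx Z *m H).
Proof.
move=> pZ; have [E uE ZE] := pdmx_sqrt pZ.
have trE : \tr Z = \tr (adjmx E *m E) by rewrite ZE mxtrace_mulC.
have := psdmx_gram (adjmx E); rewrite adjmxK => /psdmx_tr_scalar.
move=> /(psdmx_congr (adjmx H *m adjmx (invmx E))).
rewrite adjmxM !adjmxK -trE mulmxBr mulmxBl mul_mx_scalar -scalemxAl.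
have -> : adjmx H *m adjmx (invmx E) *m (adjmx E *m E) *m (invmx E *m H) = adjmx H *m H.
  by rewrite !mulmxA mulmxK // -[_ *m adjmx E]mulmxA -adjmxM mulmxV // adjmx1 mulmx1.
rewrite mulmxA -[_ *m invmx E]mulmxA -invmx_gram // -ZE => psB.
rewrite -detZ -[X in _ <= \det X](subrK (adjmx H *m H)) addrC.
apply: det_psdD_ge psB; rewrite -{2}[H]adjmxK; exact: psdmx_gram.
Qed.

Lemma det_gram_gt0 {R : realType} t r (H : 'M[R[i]]_(r, t)) :
  \rank H = t -> 0 < \det (adjmx H *m H).
Proof.
move=> rH; apply: det_pd_gt0; split; first by rewrite adjmxM adjmxK.
move=> v v0; rewrite mulmxA -mulmxA -adjmxM; apply: adjmx_gram_gt0.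
have /row_fullP [B BH] : row_full H by rewrite /row_full rH.
by apply: contra v0 => /eqP Hv; rewrite -[v]mul1mx -BH -mulmxA Hv mulmx0.
Qed.

(** * Log-determinants, capacity and the loss at a fixed channel *)

Lemma logdetE {R : realType} n (A : 'M[R[i]]_n) (x : R) :
  \det A = (x%:C)%C -> logdet A = ln x.
Proof. by rewrite /logdet => ->. Qed.

Lemma gt0_realC {R : realType} (z : R[i]) : 0 < z -> exists2 x : R, 0 < x & z = (x%:C)%C.
Proof.
move=> z0; exists (complex.Re z); last by rewrite RRe_real // gtr0_real.
by move: z0; rewrite ltcE => /andP[].
Qed.

Lemma ln_prod {R : realType} (I : finType) (f : I -> R) :
  (forall i, 0 < f i) -> ln (\prod_i f i) = \sum_i ln (f i).
Proof.
move=> f0; suff [] : 0 < \prod_i f i /\ ln (\prod_i f i) = \sum_i ln (f i) by [].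
elim/big_ind2: _ => [|x1 x2 y1 y2 [x0 xE] [y0 yE]|i _].
- by rewrite ltr01 ln1.
- by rewrite mulr_gt0 // lnM ?posrE // xE yE.
- by [].
Qed.

Lemma ln1D_le {R : realType} (x : R) : 0 <= x -> ln (1 + x) <= x.
Proof.
by move=> x0; rewrite -[leRHS]expRK ler_ln ?posrE ?expR_gt0 ?expR_ge1Dx //; lra.
Qed.

Lemma ln1D_ge0 {R : realType} (x : R) : 0 <= x -> 0 <= ln (1 + x).
Proof. by move=> x0; rewrite ln_ge0 // lerDl. Qed.

Lemma pdmxZ {R : realType} n (p : R) (A : 'M[R[i]]_n) :
  0 < p -> pdmx A -> pdmx ((p%:C)%C *: A).
Proof.
move=> p0 [hA pA]; split; first by rewrite adjmxZr -hA.
by move=> v v0; rewrite -scalemxAr -scalemxAl mxE mulr_gt0 ?pA // ltcR.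
Qed.

Lemma pdmxD {R : realType} n (A B : 'M[R[i]]_n) : pdmx A -> psdmx B -> pdmx (A + B).
Proof.
move=> [hA pA] [hB pB]; split; first by rewrite adjmxD -hA -hB.
by move=> v v0; rewrite mulmxDr mulmxDl mxE ltr_pwDl ?pA.
Qed.

Lemma logdetZ {R : realType} n (p : R) (A : 'M[R[i]]_n) :
  0 < p -> pdmx A -> logdet ((p%:C)%C *: A) = ln p *+ n + logdet A.
Proof.
move=> p0 /det_pd_gt0/gt0_realC [x x0 xE]; rewrite (logdetE xE).
have -> : logdet ((p%:C)%C *: A) = ln (p ^+ n * x).
  by apply: logdetE; rewrite detZ xE -rmorphXn -rmorphM.
by rewrite lnM ?posrE ?exprn_gt0 // lnXn.
Qed.

Definition capacity {R : realType} t r (X : 'M[R[i]]_t) (Z : 'M[R[i]]_r)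
    (H : 'M[R[i]]_(r, t)) : R :=
  logdet (Z + H *m X *m adjmx H) - logdet Z.

Lemma logdet_signal {R : realType} t r (X : 'M[R[i]]_t) (Z : 'M[R[i]]_r) :
  pdmx X -> pdmx Z -> exists2 c : R, 0 <= c & forall H : 'M[R[i]]_(r, t),
  exists d : 'I_t -> R, [/\ forall j, 0 <= d j,
    \sum_j d j <= c * frob2 H,
    ((\prod_j d j)%:C)%C = \det X * \det (adjmx H *m invmx Z *m H) &
    forall p : R, 0 < p ->
      capacity ((p%:C)%C *: X) Z H = \sum_j ln (1 + p * d j)].
Proof.
move=> pX pZ; have [c c0 cP] := det_signal_spectrum pX pZ.
exists c => // H; have [d [d0 ds dp dE]] := cP H; exists d; split=> // p p0.
have [z z0 zE] := gt0_realC (det_pd_gt0 pZ).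
have pd0 j : 0 < 1 + p * d j by rewrite ltr_pwDl // mulr_ge0 // ltW.
rewrite /capacity addrC (logdetE zE) -ln_prod //.
have -> : logdet (Z + H *m ((p%:C)%C *: X) *m adjmx H) = ln (z * \prod_j (1 + p * d j)).
  by apply: logdetE; rewrite addrC dE zE -rmorphM.
by rewrite lnM ?posrE ?prodr_gt0 // addKr.
Qed.

(** From [ln (1 + x) <= x] and the trace bound on the spectrum. At fixed power it makes the capacity
    integrable. *)
Lemma capacity_bound {R : realType} t r (X : 'M[R[i]]_t) (Z : 'M[R[i]]_r) :
  pdmx X -> pdmx Z -> exists2 c : R, 0 <= c & forall (H : 'M[R[i]]_(r, t)) (p : R),
  0 < p -> 0 <= capacity ((p%:C)%C *: X) Z H <= p * c * frob2 H.
Proof.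
move=> pX pZ; have [c c0 cP] := logdet_signal pX pZ; exists c => // H p p0.
have [d [d0 ds _ ->]] := cP H => //; apply/andP; split.
  by apply: sumr_ge0 => j _; rewrite ln1D_ge0 // mulr_ge0 // ltW.
rewrite -mulrA; apply: le_trans (ler_wpM2l (ltW p0) ds).
by rewrite mulr_sumr; apply: ler_sum => j _; rewrite ln1D_le // mulr_ge0 // ltW.
Qed.

(* [logdet X + log |H (X + S) H^* + Z| - logdet (Mmx X S Z W H)] is the rate of
   the inflation factor [W]; at [W = 1] the last term is
   [logdet (X + S) + logdet Z], and [gap] is the loss with respect to [capacity]. *)
Definition gap {R : realType} t r (X S : 'M[R[i]]_t) (Z : 'M[R[i]]_r)
    (H : 'M[R[i]]_(r, t)) : R :=
  capacity X Z H - (logdet X + logdet (H *m (X + S) *m adjmx H + Z))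
  + (logdet (X + S) + logdet Z).

Lemma logdet_Mmx1 {R : realType} t r (X S : 'M[R[i]]_t) (Z : 'M[R[i]]_r)
    (H : 'M[R[i]]_(r, t)) : pdmx X -> psdmx S -> pdmx Z ->
  logdet (Mmx X S Z 1%:M H) = logdet (X + S) + logdet Z.
Proof.
move=> pX pS /det_pd_gt0/gt0_realC [z z0 zE].
have /det_pd_gt0/gt0_realC [v v0 vE] := pdmxD pX pS.
rewrite (logdetE zE) (logdetE vE) -lnM //; apply: logdetE.
by rewrite det_Mmx1 vE zE -rmorphM.
Qed.

Lemma logdet_Mmx_ge {R : realType} t r (X S W : 'M[R[i]]_t) (Z : 'M[R[i]]_r)
    (H : 'M[R[i]]_(r, t)) : pdmx X -> psdmx S -> pdmx Z ->
  logdet X + logdet (H *m (X + S) *m adjmx H + Z) - capacity X Z H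
  <= logdet (Mmx X S Z W H).
Proof.
move=> pX pS pZ.
have /det_pd_gt0/gt0_realC [z z0 zE] := pZ.
have /det_pd_gt0/gt0_realC [x x0 xE] := pX.
have /det_pd_gt0/gt0_realC [n n0 nE] := pdmx_congrD H (pdmx_psd pX) pZ.
have /det_pd_gt0/gt0_realC [u u0 uE] := pdmx_congrD H (psdmxD (pdmx_psd pX) pS) pZ.
have := det_Mmx_ge W H (pdmx_psd pX) pS pZ; rewrite /capacity [Z + _]addrC.
rewrite (logdetE zE) (logdetE xE) (logdetE nE) (logdetE uE) /logdet xE zE nE uE.
(* Comparing logarithms needs a positive real part [m1]; this follows from the inequality itself,
   whose smaller side is positive. *)
case: (\det _) => m1 m2; rewrite -!rmorphM lecE /= !mulr0 subr0 => /andP[_ mP].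
have m0 : 0 < m1.
  rewrite -(pmulr_lgt0 _ n0); apply: lt_le_trans mP; by rewrite !mulr_gt0.
have : ln (x * z * u) <= ln (m1 * n).
  by rewrite ler_ln ?posrE ?mulr_gt0.
by rewrite !lnM ?posrE ?mulr_gt0 //; lra.
Qed.

Lemma gap_ge0 {R : realType} t r (X S : 'M[R[i]]_t) (Z : 'M[R[i]]_r)
    (H : 'M[R[i]]_(r, t)) : pdmx X -> psdmx S -> pdmx Z -> 0 <= gap X S Z H.
Proof.
move=> pX pS pZ; have := logdet_Mmx_ge 1%:M H pX pS pZ.
by rewrite logdet_Mmx1 // /gap; lra.
Qed.

(** Factoring [1 + p d = p d (1 + (p d)^-1)] separates the growth in [ln p] from a remainder that
    vanishes at high power. *)
Lemma sum_ln1D {R : realType} n (d : 'I_n -> R) (p : R) : 0 < p ->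
  (forall j, 0 < d j) ->
  \sum_j ln (1 + p * d j) =
  ln p *+ n + ln (\prod_j d j) + \sum_j ln (1 + (p * d j)^-1).
Proof.
move=> p0 d0; rewrite ln_prod //; have -> : ln p *+ n = \sum_(j < n) ln p.
  by rewrite sumr_const card_ord.
rewrite -!big_split /=; apply: eq_bigr => j _.
have pd0 : 0 < p * d j by rewrite mulr_gt0.
rewrite -!lnM ?posrE ?mulr_gt0 // ?addr_gt0 ?invr_gt0 //.
by rewrite mulrDr mulr1 mulfV ?gt_eqF // addrC.
Qed.

(** The spectra [d] for [X] and [e] for [X + S] contribute the same [ln p] growth and the same
    [ln |H^* Z^-1 H|]. These cancel, as do the terms in [|X|] and [|X + S|], and only the difference
    of the two remainders is left. The constants are uniform in [H], as domination requires. *)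
Lemma gap_asymptotics {R : realType} t r (X S : 'M[R[i]]_t) (Z : 'M[R[i]]_r) :
  pdmx X -> psdmx S -> pdmx Z -> exists c k : R, 0 <= c /\
  forall H : 'M[R[i]]_(r, t), \rank H = t ->
  (forall p : R, 1 <= p -> gap ((p%:C)%C *: X) ((p%:C)%C *: S) Z H <=
    k + c * frob2 H + `|logdet (adjmx H *m H)|) /\
  gap ((p%:C)%C *: X) ((p%:C)%C *: S) Z H @[p --> +oo] --> (0 : R).
Proof.
move=> pX pS pZ; have pV := pdmxD pX pS.
have [c c0 cP] := logdet_signal pX pZ.
have [c' _ cP'] := logdet_signal pV pZ.
have [tau tau0 tauE] : exists2 tau : R, 0 <= tau & \tr Z = (tau%:C)%C.
  have [d [d0 -> _]] := det_scalarD_psd (pdmx_psd pZ).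
  by exists (\sum_j d j) => //; exact: sumr_ge0.
(* [c] comes from the trace of the spectrum of [X]; [ln (tau ^+ t)] is the price of replacing
   [H^* Z^-1 H] by [H^* H]. *)
exists c, (ln (tau ^+ t) - logdet X); split=> // H rH.
have [x x0 xE] := gt0_realC (det_pd_gt0 pX).
have [v v0 vE] := gt0_realC (det_pd_gt0 pV).
have [h h0 hE] := gt0_realC (det_gram_gt0 rH).
have [d [d0 ds dp dE]] := cP H; have [e [e0 _ ep eE]] := cP' H.
(* The real value of [|H^* Z^-1 H|], a factor common to the products of both spectra. *)
pose g := (\prod_j e j) / v.
have gE : \det (adjmx H *m invmx Z *m H) = (g%:C)%C.
  apply: (@mulfI _ (\det (X + S))); first by rewrite (gt_eqF (det_pd_gt0 pV)).
  rewrite -ep vE -rmorphM /g.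
  by rewrite mulrCA mulfV ?gt_eqF // mulr1.
have := det_gram_le H pZ; rewrite tauE gE hE -rmorphXn -rmorphM lecR => hg.
have tg0 : 0 < tau ^+ t * g by exact: lt_le_trans hg.
have taut0 : 0 < tau ^+ t.
  rewrite lt0r exprn_ge0 // andbT; apply/negP => /eqP t0.
  by rewrite t0 mul0r ltxx in tg0.
have g0 : 0 < g by rewrite pmulr_rgt0 in tg0.
have {}dp : \prod_j d j = x * g by apply: complexI; rewrite dp xE gE -rmorphM.
have {}ep : \prod_j e j = v * g by apply: complexI; rewrite ep vE gE -rmorphM.
clearbody g.
(* Full rank of [H] gives [g > 0], so no eigenvalue vanishes and the inverses below are genuine. *)
have {}d0 j : 0 < d j.
  rewrite lt0r d0 andbT; have : \prod_j d j != 0 by rewrite dp gt_eqF ?mulr_gt0 //.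
  by move=> /prodf_neq0; exact.
have {}e0 j : 0 < e j.
  rewrite lt0r e0 andbT; have : \prod_j e j != 0 by rewrite ep gt_eqF ?mulr_gt0 //.
  by move=> /prodf_neq0; exact.
pose A p := \sum_j ln (1 + (p * d j)^-1); pose B p := \sum_j ln (1 + (p * e j)^-1).
have gapE p : 0 < p -> gap ((p%:C)%C *: X) ((p%:C)%C *: S) Z H = A p - B p.
  move=> p0; rewrite /gap -scalerDr dE // (logdetZ p0 pX) (logdetZ p0 pV).
  have -> : logdet (H *m ((p%:C)%C *: (X + S)) *m adjmx H + Z) =
      \sum_j ln (1 + p * e j) + logdet Z.
    by rewrite -eE // /capacity [Z + _]addrC subrK.
  rewrite !sum_ln1D // dp ep (logdetE xE) (logdetE vE) !lnM ?posrE //.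
  by rewrite /A /B; ring.
split.
  move=> p p1; have p0 : 0 < p by exact: lt_le_trans p1.
  rewrite gapE //; have B0 : 0 <= B p.
    by apply: sumr_ge0 => j _; rewrite ln1D_ge0 // invr_ge0 mulr_ge0 ?ltW.
  (* [B] is nonnegative and [A] is nonincreasing, so a bound at [p = 1] covers all [p >= 1]. *)
  have AA1 : A p <= A 1.
    apply: ler_sum => j _; rewrite ler_ln ?posrE ?addr_gt0 ?invr_gt0 ?mulr_gt0 //.
    by rewrite lerD2l lef_pV2 ?posrE ?mulr_gt0 // ler_wpM2r // ltW.
  have A1 : A 1 = \sum_j ln (1 + d j) - ln (\prod_j d j).
    have -> : \sum_j ln (1 + d j) = \sum_j ln (1 + 1 * d j).
      by apply: eq_bigr => j _; rewrite mul1r.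
    by rewrite sum_ln1D // ln1 mul0rn add0r addrAC subrr add0r.
  have lnd : \sum_j ln (1 + d j) <= c * frob2 H.
    by apply: le_trans ds; apply: ler_sum => j _; rewrite ln1D_le // ltW.
  have lng : ln h <= ln (tau ^+ t) + ln g by rewrite -lnM ?posrE // ler_ln ?posrE.
  have := ler_norm (- ln h); rewrite normrN (logdetE hE) (logdetE xE) => lnh.
  rewrite dp lnM ?posrE // in A1; lra.
have cvgS (f : 'I_t -> R) : (forall j, 0 < f j) ->
    \sum_j ln (1 + (p * f j)^-1) @[p --> +oo] --> (0 : R).
  move=> f0; rewrite [X in _ --> X](_ : _ = \sum_(j < t) (0 : R)); last by rewrite big1.
  apply: cvg_big => [|j _]; first exact: add_continuous.
  rewrite -[X in _ --> X](@ln1 R).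
  apply: continuous_cvg; first exact: continuous_ln.
  rewrite -[X in _ --> X](addr0 (1 : R)); apply: cvgD; first exact: cvg_cst.
  have fy : p * f j @[p --> +oo] --> +oo by apply: (gt0_cvgMly (f0 j)); exact: cvg_id.
  have fpos : \forall p \near +oo, 0 < p * f j by near=> p; rewrite mulr_gt0.
  exact: ((gtr0_cvgV0 fpos).2 fy).
apply: cvg_trans (_ : A p - B p @[p --> +oo] --> (0 : R)).
  apply: near_eq_cvg; near=> p; rewrite gapE //.
rewrite -[X in _ --> X](subrr (0 : R)); apply: cvgB; exact: cvgS.
Unshelve. all: by end_near. Qed.

(** * Measurability and integrals *)

(** Stated through real and imaginary parts, the form in which the channel is assumed measurable. *)
Definition cmeasurable {d} {T : measurableType d} {R : realType} (f : T -> R[i]) :=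
  measurable_fun setT (fun w => complex.Re (f w)) /\
  measurable_fun setT (fun w => complex.Im (f w)).

Definition mxmeasurable {d} {T : measurableType d} {R : realType} m n
    (A : T -> 'M[R[i]]_(m, n)) :=
  forall i j, cmeasurable (fun w => A w i j).

Section MeasurableMatrices.
Context {d : measure_display} {T : measurableType d} {R : realType}.

Lemma cmeasurable_cst (c : R[i]) : cmeasurable (fun _ : T => c).
Proof. by split; exact: measurable_cst. Qed.

Lemma cmeasurableD (f g : T -> R[i]) :
  cmeasurable f -> cmeasurable g -> cmeasurable (fun w => f w + g w).
Proof.
move=> [fr fi] [gr gi]; split.
  rewrite (_ : (fun w => _) = fun w => complex.Re (f w) + complex.Re (g w)).
    exact: measurable_funD.
  by apply/funext => w; case: (f w); case: (g w).
rewrite (_ : (fun w => _) = fun w => complex.Im (f w) + complex.Im (g w)).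
  exact: measurable_funD.
by apply/funext => w; case: (f w); case: (g w).
Qed.

Lemma cmeasurableM (f g : T -> R[i]) :
  cmeasurable f -> cmeasurable g -> cmeasurable (fun w => f w * g w).
Proof.
move=> [fr fi] [gr gi]; split.
  rewrite (_ : (fun w => _) = fun w => complex.Re (f w) * complex.Re (g w)
      - complex.Im (f w) * complex.Im (g w)).
    by apply: measurable_funB; exact: measurable_funM.
  by apply/funext => w; case: (f w); case: (g w).
rewrite (_ : (fun w => _) = fun w => complex.Re (f w) * complex.Im (g w)
    + complex.Im (f w) * complex.Re (g w)).
  by apply: measurable_funD; exact: measurable_funM.
by apply/funext => w; case: (f w); case: (g w).
Qed.

Lemma cmeasurable_conj (f : T -> R[i]) :
  cmeasurable f -> cmeasurable (fun w => Num.conj (f w)).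
Proof.
move=> [fr fi]; split.
  rewrite (_ : (fun w => _) = fun w => complex.Re (f w)) //.
  by apply/funext => w; case: (f w).
rewrite (_ : (fun w => _) = fun w => - complex.Im (f w)).
  exact: measurableT_comp.
by apply/funext => w; case: (f w).
Qed.

Lemma cmeasurable_sum (I : Type) (s : seq I) (P : pred I) (f : I -> T -> R[i]) :
  (forall i, cmeasurable (f i)) -> cmeasurable (fun w => \sum_(i <- s | P i) f i w).
Proof.
move=> mf; elim: s => [|i s IH].
  by under eq_fun do rewrite big_nil; exact: cmeasurable_cst.
under eq_fun do rewrite big_cons.
by case: (P i) => //; exact: cmeasurableD.
Qed.

Lemma cmeasurable_prod (I : Type) (s : seq I) (P : pred I) (f : I -> T -> R[i]) :
  (forall i, cmeasurable (f i)) -> cmeasurable (fun w => \prod_(i <- s | P i) f i w).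
Proof.
move=> mf; elim: s => [|i s IH].
  by under eq_fun do rewrite big_nil; exact: cmeasurable_cst.
under eq_fun do rewrite big_cons.
by case: (P i) => //; exact: cmeasurableM.
Qed.

Lemma mxmeasurable_cst m n (A : 'M[R[i]]_(m, n)) : mxmeasurable (fun _ : T => A).
Proof. by move=> i j; exact: cmeasurable_cst. Qed.

Lemma mxmeasurableD m n (A B : T -> 'M[R[i]]_(m, n)) :
  mxmeasurable A -> mxmeasurable B -> mxmeasurable (fun w => A w + B w).
Proof. by move=> mA mB i j; under eq_fun do rewrite mxE; exact: cmeasurableD. Qed.

Lemma mxmeasurableM m n p (A : T -> 'M[R[i]]_(m, n)) (B : T -> 'M[R[i]]_(n, p)) :
  mxmeasurable A -> mxmeasurable B -> mxmeasurable (fun w => A w *m B w).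
Proof.
move=> mA mB i j; under eq_fun do rewrite mxE.
by apply: cmeasurable_sum => l; exact: cmeasurableM.
Qed.

Lemma mxmeasurable_adj m n (A : T -> 'M[R[i]]_(m, n)) :
  mxmeasurable A -> mxmeasurable (fun w => adjmx (A w)).
Proof. by move=> mA i j; under eq_fun do rewrite !mxE; exact: cmeasurable_conj. Qed.

Lemma measurable_logdet n (A : T -> 'M[R[i]]_n) :
  mxmeasurable A -> measurable_fun setT (fun w => logdet (A w)).
Proof.
move=> mA; apply: measurableT_comp => //.
suff [] : cmeasurable (fun w => \det (A w)) by [].
(* The Leibniz formula: a signed sum over permutations of products of entries. *)
apply: cmeasurable_sum => s; apply: cmeasurableM; first exact: cmeasurable_cst.
by apply: cmeasurable_prod => i; exact: mA.
Qed.

Lemma measurable_frob2 m n (A : T -> 'M[R[i]]_(m, n)) :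
  mxmeasurable A -> measurable_fun setT (fun w => frob2 (A w)).
Proof.
move=> mA; apply: measurable_sum => i; apply: measurable_sum => j.
by have [mr mi] := mA i j; apply: measurable_funD; apply: measurable_funX.
Qed.

End MeasurableMatrices.

Lemma measurable_capacity {d} {T : measurableType d} {R : realType} t r
    (H : T -> 'M[R[i]]_(r, t)) (X : 'M[R[i]]_t) (Z : 'M[R[i]]_r) :
  mxmeasurable H -> measurable_fun setT (fun w => capacity X Z (H w)).
Proof.
move=> mH; apply: measurable_funB => //; apply: measurable_logdet.
apply: mxmeasurableD; first exact: mxmeasurable_cst.
apply: mxmeasurableM; last exact: mxmeasurable_adj.
by apply: mxmeasurableM => //; exact: mxmeasurable_cst.
Qed.

Lemma measurable_gap {d} {T : measurableType d} {R : realType} t r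
    (H : T -> 'M[R[i]]_(r, t)) (X S : 'M[R[i]]_t) (Z : 'M[R[i]]_r) :
  mxmeasurable H -> measurable_fun setT (fun w => gap X S Z (H w)).
Proof.
move=> mH; apply: measurable_funD => //; apply: measurable_funB.
  exact: measurable_capacity.
apply: measurable_funD => //; apply: measurable_logdet.
apply: mxmeasurableD; last exact: mxmeasurable_cst.
apply: mxmeasurableM; last exact: mxmeasurable_adj.
by apply: mxmeasurableM => //; exact: mxmeasurable_cst.
Qed.

(** * Comparison of integrals and dominated convergence along a kernel *)

Import HBNNSimple.
(** The integral is a supremum over simple functions below the integrand. A simple function below
    [f], set to 0 on the exceptional null set, lies below [g] and keeps its integral. *)
Lemma ge0_ae_le_integralT {d} {T : measurableType d} {R : realType}
    (mu : {measure set T -> \bar R}) (f g : T -> \bar R) :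
  (forall x, 0 <= f x)%E -> (forall x, 0 <= g x)%E ->
  {ae mu, forall x, f x <= g x}%E -> (\int[mu]_x f x <= \int[mu]_x g x)%E.
Proof.
move=> f0 g0 [N [mN N0 fgN]]; rewrite !ge0_integralTE //.
apply: ge_ereal_sup => _ [h /= hf <-].
have mC : measurable (setT `\` N) by exact: measurableD.
rewrite -integralT_nnsfun (ge0_negligible_integral mN) //; last 2 first.
- exact/measurable_EFinP/measurable_funTS.
- by move=> x _; rewrite lee_fin fun_ge0.
rewrite integral_nnsfun // (mrestrict h mC).
apply: ereal_sup_ubound; exists (proj_nnsfun h mC) => // x.
rewrite -(mrestrict h mC) patchE; case: ifPn => // xC.
apply: le_trans (hf x) _; move: xC; rewrite inE => -[_ xN].
by apply: contrapT => fg; apply: xN; exact: fgN.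
Qed.

(* No measurability is assumed: the infimum over W in the rate need not be a
   measurable function of the side information. *)
Lemma ae_le_integralT {d} {T : measurableType d} {R : realType}
    (mu : {measure set T -> \bar R}) (f g : T -> \bar R) :
  {ae mu, forall x, f x <= g x}%E -> (\int[mu]_x f x <= \int[mu]_x g x)%E.
Proof.
move=> fg; rewrite integralE [leRHS]integralE; apply: leeB.
  apply: ge0_ae_le_integralT => //; apply: filterS fg => x fgx.
  by have := @funepos_le _ _ [set x] f g; apply; rewrite ?inE // => y; rewrite inE => ->.
apply: ge0_ae_le_integralT => //; apply: filterS fg => x fgx.
by have := @funeneg_le _ _ [set x] f g; apply; rewrite ?inE // => y; rewrite inE => ->.
Qed.

Lemma integrable_ge0 {d} {T : measurableType d} {R : realType}
    (mu : {measure set T -> \bar R}) (f : T -> \bar R) :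
  measurable_fun setT f -> (forall x, 0 <= f x)%E -> (\int[mu]_x f x < +oo)%E ->
  mu.-integrable setT f.
Proof.
move=> mf f0 foo; apply/integrableP; split => //.
by under eq_integral do rewrite gee0_abs //.
Qed.

Lemma measurable_kernel_integral {d d'} {X : measurableType d}
    {T : measurableType d'} {R : realType} (k : R.-pker X ~> T) (f : T -> R) :
  measurable_fun setT f -> (forall x, 0 <= f x) ->
  measurable_fun setT (fun y => \int[k y]_x (f x)%:E)%E.
Proof.
move=> mf f0; apply: measurable_fun_integral_kernel.
- by move=> U mU; exact: measurable_kernel.
- by move=> x; rewrite lee_fin.
- exact/measurable_EFinP.
Qed.

Lemma EFin_integral_ge0 {d} {T : measurableType d} {R : realType}
    (mu : {measure set T -> \bar R}) (f : T -> R) :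
  (forall x, 0 <= f x) -> (0 <= \int[mu]_x (f x)%:E)%E.
Proof. by move=> f0; apply: integral_ge0 => x _; rewrite lee_fin. Qed.

(** Dominated convergence twice: under [k y] with bound [g], then under [mu] with the inner integral
    of [g] as bound, which is finite for almost every [y]. *)
Lemma kernel_dominated_cvg0 {d d'} {X : measurableType d}
    {T : measurableType d'} {R : realType} (mu : {measure set X -> \bar R})
    (k : R.-pker X ~> T) (f : nat -> T -> R) (g : T -> R) :
  (forall n, measurable_fun setT (f n)) -> measurable_fun setT g ->
  (forall n x, 0 <= f n x) -> (forall x, 0 <= g x) ->
  (\int[mu]_y \int[k y]_x (g x)%:E < +oo)%E ->
  {ae mu, forall y, {ae k y, forall x, (forall n, f n x <= g x) /\
     (f n x @[n --> \oo] --> (0 : R))}} ->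
  ((\int[mu]_y \int[k y]_x (f n x)%:E)%E @[n --> \oo] --> (0 : \bar R)).
Proof.
move=> mf mg f0 g0 goo fg.
have mF n : measurable_fun setT (fun y => \int[k y]_x (f n x)%:E)%E.
  exact: measurable_kernel_integral.
have mG : measurable_fun setT (fun y => \int[k y]_x (g x)%:E)%E.
  exact: measurable_kernel_integral.
have F0 n y : (0 <= \int[k y]_x (f n x)%:E)%E.
  exact: EFin_integral_ge0.
have iG : mu.-integrable setT (fun y => \int[k y]_x (g x)%:E)%E.
  by apply: integrable_ge0 goo => // y; exact: EFin_integral_ge0.
have Gfin := integrable_ae measurableT iG.
have cvgF : {ae mu, forall y, setT y ->
    (\int[k y]_x (f n x)%:E)%E @[n --> \oo] --> (0 : \bar R)}.
  apply: filterS2 Gfin fg => y Gy fgy _.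
  have ig : (k y).-integrable setT (EFin \o g).
    apply: integrable_ge0 => [|x|]; first exact/measurable_EFinP.
      by rewrite lee_fin.
    by rewrite ltey_eq Gy.
  have cvgf : {ae k y, forall x, setT x -> (f n x)%:E @[n --> \oo] --> (0 : \bar R)}.
    by apply: filterS fgy => x [_ fx] _; apply: cvg_EFin => //; exact: nearW.
  have domf : {ae k y, forall x n, setT x -> (`|(f n x)%:E| <= (g x)%:E)%E}.
    by apply: filterS fgy => x [fx _] n _; rewrite gee0_abs ?lee_fin.
  have [_ _] := dominated_convergence measurableT
    (fun n => (measurable_EFinP _ _).2 (mf n)) (measurable_cst _) cvgf ig domf.
  by rewrite integral0.
have domF : {ae mu, forall y n, setT y ->
    (`|\int[k y]_x (f n x)%:E| <= \int[k y]_x (g x)%:E)%E}.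
  apply: filterS fg => y fgy n _; rewrite gee0_abs //.
  by apply: ae_le_integralT; apply: filterS fgy => x [fx _]; rewrite lee_fin.
have [_ _] := dominated_convergence measurableT mF (measurable_cst _) cvgF iG domF.
by rewrite integral0.
Qed.

(** * Bounds on the conditional rate and the limit of the mean loss *)

Lemma integrable_cst1 {d} {T : measurableType d} {R : realType}
    (mu : {measure set T -> \bar R}) (c : R) :
  mu setT = 1%E -> mu.-integrable setT (fun=> c%:E).
Proof.
move=> mu1; apply/integrableP; split; first exact: measurable_cst.
by rewrite integral_cst // mu1 mule1 ltry.
Qed.

(** Here [mu] is the conditional law of the channel given the side information. The upper bound on
    the rate uses the determinant inequality for every [W]; the lower one evaluates the infimum at
    [W = 1]. *)
Lemma rate_sandwich {R : realType} (t r : nat) {d} {Omega : measurableType d}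
  (mu : {measure set Omega -> \bar R}) (H : Omega -> 'M[R[i]]_(r, t))
  (Z : 'M[R[i]]_r) (X S : 'M[R[i]]_t) (p : R) : 0 < p -> mu setT = 1%E ->
  mxmeasurable H -> pdmx Z -> pdmx X -> psdmx S ->
  (\int[mu]_w (frob2 (H w))%:E < +oo)%E ->
  let X' := (p%:C)%C *: X in let S' := (p%:C)%C *: S in
  is_true (\int[mu]_w (capacity X' Z (H w))%:E - \int[mu]_w (gap X' S' Z (H w))%:E
   <= \int[mu]_w (logdet X' + logdet (H w *m (X' + S') *m adjmx (H w) + Z))%:E
      - ereal_inf [set \int[mu]_w (logdet (Mmx X' S' Z W (H w)))%:E
                  | W in [set: 'M[R[i]]_t]]
   <= \int[mu]_w (capacity X' Z (H w))%:E)%E.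
Proof.
move=> p0 mu1 mH pZ pX pS Hoo X' S'.
have pX' : pdmx X' by exact: pdmxZ.
have pS' : psdmx S' by apply: psdmxZ => //; exact: ltW.
pose a w := logdet X' + logdet (H w *m (X' + S') *m adjmx (H w) + Z).
pose b w := capacity X' Z (H w).
pose m := logdet (X' + S') + logdet Z.
pose g w := gap X' S' Z (H w).
have gE w : g w = b w - a w + m by [].
have ma : measurable_fun setT a.
  apply: measurable_funD => //; apply: measurable_logdet.
  apply: mxmeasurableD; last exact: mxmeasurable_cst.
  apply: mxmeasurableM; last exact: mxmeasurable_adj.
  by apply: mxmeasurableM => //; exact: mxmeasurable_cst.
have mb : measurable_fun setT b by exact: measurable_capacity.
have ifrob : mu.-integrable setT (EFin \o (fun w => frob2 (H w))).
  apply: integrable_ge0 => [|w|//]; last by rewrite lee_fin frob2_ge0.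
  by apply/measurable_EFinP; exact: measurable_frob2.
(* Every integrand here is dominated by an affine function of the squared Frobenius norm. *)
have dom (f : Omega -> R) (c k : R) : measurable_fun setT f ->
    (forall w, `|f w| <= k + c * frob2 (H w)) -> mu.-integrable setT (EFin \o f).
  move=> mf fk; apply: (@le_integrable _ _ _ mu _ measurableT _
      (fun w => k%:E + c%:E * (frob2 (H w))%:E)%E); first exact/measurable_EFinP.
    by move=> w _; rewrite -EFinM -EFinD /= lee_fin (le_trans (fk w)) // ler_norm.
  apply: integrableD => //; first exact: integrable_cst1.
  exact: integrableZl.
have [c c0 cb] := capacity_bound pX pZ.
have [c' c'0 cb'] := capacity_bound (pdmxD pX pS) pZ.
have ib : mu.-integrable setT (EFin \o b).
  apply: (dom _ (p * c) 0) => // w; rewrite add0r.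
  by have /andP[b0 bc] := cb (H w) p p0; rewrite ger0_norm.
have ia : mu.-integrable setT (EFin \o a).
  (* The log-determinant of the received covariance is the capacity for input covariance [X' + S']
     plus [logdet Z]. *)
  apply: (dom _ (p * c') (`|logdet X'| + `|logdet Z|)) => // w.
  have /andP[] := cb' (H w) p p0.
  rewrite /capacity scalerDr [Z + _]addrC -/X' -/S' => a0 ac.
  rewrite /a -addrA; apply: le_trans (ler_normD _ _) _; rewrite lerD2l.
  rewrite [leRHS]addrC -[X in `|X|](subrK (logdet Z)).
  by apply: le_trans (ler_normD _ _) _; rewrite lerD2r ger0_norm.
have bfin : (\int[mu]_w (b w)%:E)%E \is a fin_num by exact: integral_fune_fin_num.
have afin : (\int[mu]_w (a w)%:E)%E \is a fin_num by exact: integral_fune_fin_num.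
set J := ereal_inf _.
have int_m : (\int[mu]_w m%:E = m%:E)%E.
  by rewrite integral_cst // [X in (_ * X)%E]mu1 mule1.
have Jm : (J <= m%:E)%E.
  apply: ereal_inf_lbound; exists 1%:M => //.
  under eq_integral do rewrite logdet_Mmx1 //.
  exact: int_m.
have abJ : (\int[mu]_w (a w)%:E - \int[mu]_w (b w)%:E <= J)%E.
  apply: le_ereal_inf_tmp => _ [W _ <-].
  rewrite -integralB //; apply: ae_le_integralT; apply: aeW => w.
  by rewrite -EFinB lee_fin; exact: logdet_Mmx_ge.
have gab : (\int[mu]_w (g w)%:E = \int[mu]_w (b w)%:E - \int[mu]_w (a w)%:E + m%:E)%E.
  rewrite -integralB // -int_m -integralD //; first exact: integrableB.
  exact: integrable_cst1.
(* The infimum lies between two finite values, so the extended inequalities reduce to real ones. *)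
have Jfin : J \is a fin_num.
  rewrite fin_numE; apply/andP; split.
    apply/eqP => JN; move: abJ; rewrite JN leeNy_eq => /eqP.
    by rewrite -(fineK afin) -(fineK bfin).
  by apply/eqP => JN; move: Jm; rewrite JN leye_eq.
suff : (\int[mu]_w (b w)%:E - \int[mu]_w (g w)%:E <= \int[mu]_w (a w)%:E - J
    <= \int[mu]_w (b w)%:E)%E by [].
rewrite gab; move: Jm abJ; rewrite -(fineK afin) -(fineK bfin) -(fineK Jfin).
rewrite -EFinB -EFinD -!EFinB !lee_fin => Jm abJ; apply/andP; split; lra.
Qed.

Lemma kernel_integral_ltyD {d d'} {X : measurableType d} {T : measurableType d'}
    {R : realType} (mu : {measure set X -> \bar R}) (k : R.-pker X ~> T) (f g : T -> R) :
  measurable_fun setT f -> measurable_fun setT g ->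
  (forall x, 0 <= f x) -> (forall x, 0 <= g x) ->
  (\int[mu]_y \int[k y]_x (f x)%:E < +oo)%E ->
  (\int[mu]_y \int[k y]_x (g x)%:E < +oo)%E ->
  (\int[mu]_y \int[k y]_x (f x + g x)%:E < +oo)%E.
Proof.
move=> mf mg f0 g0 foo goo.
under eq_integral => y _.
  under eq_integral do rewrite EFinD.
  rewrite ge0_integralD //; [|by move=> x _; rewrite lee_fin|exact/measurable_EFinP
    |by move=> x _; rewrite lee_fin|exact/measurable_EFinP].
  over.
rewrite ge0_integralD; first exact: lte_add_pinfty.
- by [].
- by move=> y _; exact: EFin_integral_ge0.
- exact: measurable_kernel_integral.
- by move=> y _; exact: EFin_integral_ge0.
- exact: measurable_kernel_integral.
Qed.

Lemma kernel_integral_ltyZ {d d'} {X : measurableType d} {T : measurableType d'}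
    {R : realType} (mu : {measure set X -> \bar R}) (k : R.-pker X ~> T) (c : R)
    (f : T -> R) :
  measurable_fun setT f -> 0 <= c -> (forall x, 0 <= f x) ->
  (\int[mu]_y \int[k y]_x (f x)%:E < +oo)%E ->
  (\int[mu]_y \int[k y]_x (c * f x)%:E < +oo)%E.
Proof.
move=> mf c0 f0 foo.
under eq_integral => y _.
  under eq_integral do rewrite EFinM.
  rewrite ge0_integralZl //; [|exact/measurable_EFinP|by move=> x _; rewrite lee_fin].
  over.
rewrite ge0_integralZl //; first by rewrite lte_mul_pinfty.
- exact: measurable_kernel_integral.
- by move=> y _; exact: EFin_integral_ge0.
Qed.

Lemma mean_gap_cvg0 {R : realType} (t r : nat) {dY dO}
  {Y : measurableType dY} {Omega : measurableType dO}
  (mu : probability Y R) (k : R.-pker Y ~> Omega)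
  (H : Omega -> 'M[R[i]]_(r, t)) (Z : 'M[R[i]]_r) (X S : 'M[R[i]]_t) :
  mxmeasurable H ->
  {ae mu, forall y, {ae k y, forall w, \rank (H w) = t}} ->
  (\int[mu]_y \int[k y]_w (frob2 (H w))%:E < +oo)%E ->
  (\int[mu]_y \int[k y]_w `|logdet (adjmx (H w) *m H w)|%:E < +oo)%E ->
  pdmx Z -> pdmx X -> psdmx S ->
  (\int[mu]_y \int[k y]_w (gap ((p%:C)%C *: X) ((p%:C)%C *: S) Z (H w))%:E)%E
    @[p --> +oo] --> (0 : \bar R).
Proof.
move=> mH rk Hoo Koo pZ pX pS.
have [c [l [c0 gapP]]] := gap_asymptotics pX pS pZ.
have mfrob := measurable_frob2 mH.
have mK : measurable_fun setT (fun w => `|logdet (adjmx (H w) *m H w)|).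
  apply: measurableT_comp => //; apply: measurable_logdet.
  by apply: mxmeasurableM => //; exact: mxmeasurable_adj.
(* Dominated convergence works along sequences, and the bound on the loss holds only for powers at
   least 1; truncating at 1 changes only finitely many terms. *)
apply/cvge_pinftyP => u uoo; pose v n := Num.max 1 (u n).
have v1 n : 1 <= v n by rewrite le_max lexx.
have v0 n : 0 < v n by exact: lt_le_trans (v1 n).
have uv : \forall n \near \oo, v n = u n.
  by move/cvgryPge: uoo => /(_ 1); apply: filterS => n u1; apply/max_idPr.
have voo : v n @[n --> \oo] --> +oo.
  by apply: cvg_trans uoo; apply: near_eq_cvg; apply: filterS uv => n ->.
(* The absolute value of [l] keeps the dominating function nonnegative. *)
pose g w := `|l| + c * frob2 (H w) + `|logdet (adjmx (H w) *m H w)|.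
pose f n w := gap (((v n)%:C)%C *: X) (((v n)%:C)%C *: S) Z (H w).
have : (\int[mu]_y \int[k y]_w (f n w)%:E)%E @[n --> \oo] --> (0 : \bar R).
  have cf0 w : 0 <= c * frob2 (H w) by rewrite mulr_ge0 ?frob2_ge0.
  have mcf : measurable_fun setT (fun w => c * frob2 (H w)) by exact: measurable_funM.
  apply: (@kernel_dominated_cvg0 _ _ _ _ _ _ _ f g).
  - by move=> n; exact: measurable_gap.
  - by apply: measurable_funD => //; exact: measurable_funD.
  - move=> n w; apply: gap_ge0 => //; first exact: pdmxZ.
    by apply: psdmxZ => //; exact: ltW.
  - by move=> w; rewrite !addr_ge0.
  - apply: kernel_integral_ltyD Koo; first exact: measurable_funD.
    + exact: mK.
    + by move=> w; rewrite addr_ge0.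
    + by move=> w; exact: normr_ge0.
    apply: kernel_integral_ltyD; [exact: measurable_cst|exact: mcf| |exact: cf0| |].
    + by move=> w; exact: normr_ge0.
    + under eq_integral do rewrite integral_cst // [X in (_ * X)%E]prob_kernel mule1.
      by rewrite integral_cst // [X in (_ * X)%E]probability_setT mule1 ltry.
    + exact: kernel_integral_ltyZ mfrob c0 (fun w => frob2_ge0 (H w)) Hoo.
  - apply: filterS rk => y; apply: filterS => w rw; have [gb gc] := gapP _ rw; split.
      move=> n; apply: le_trans (gb _ (v1 n)) _.
      by rewrite lerD2r lerD2r ler_norm.
    exact: (cvg_comp _ _ voo gc).
apply: cvg_trans; apply: near_eq_cvg; apply: filterS uv => n <- //.
Qed.

Theorem theorem2 (R : realType) (t r : nat)
  (dY dO : measure_display) (Y : measurableType dY) (Omega : measurableType dO)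
  (mu : probability Y R) (k : R.-pker Y ~> Omega)
  (H : Omega -> 'M[R[i]]_(r, t))
  (SZ : 'M[R[i]]_r) (SX' SS' : 'M[R[i]]_t) :
  (1 <= t)%N -> (t <= r)%N ->
  (forall i j, measurable_fun setT (fun w => complex.Re (H w i j))) ->
  (forall i j, measurable_fun setT (fun w => complex.Im (H w i j))) ->
  {ae mu, forall y, {ae k y, forall w, \rank (H w) = t}} ->
  (\int[mu]_y \int[k y]_w (frob2 (H w))%:E < +oo)%E ->
  (\int[mu]_y \int[k y]_w `|logdet (adjmx (H w) *m H w)|%:E < +oo)%E ->
  pdmx SZ -> pdmx SX' -> \tr SX' <= 1 -> psdmx SS' ->
  let SX (P : R) := (P%:C)%C *: SX' in
  let SS (P : R) := (P%:C)%C *: SS' in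
  let R0 (P : R) : \bar R :=
    (\int[mu]_y \int[k y]_w
       (logdet (SZ + H w *m SX P *m adjmx (H w)) - logdet SZ)%:E)%E in
  let Rate (P : R) : \bar R :=
    (\int[mu]_y
       ((\int[k y]_w
           (logdet (SX P) + logdet (H w *m (SX P + SS P) *m adjmx (H w) + SZ))%:E)
        - ereal_inf [set (\int[k y]_w (logdet (Mmx (SX P) (SS P) SZ W (H w)))%:E)
                    | W in [set: 'M[R[i]]_t]]))%E in
  ((fun P => R0 P - Rate P)%E @ +oo --> (0 : \bar R)).
Proof.
move=> _ _ mRe mIm rk Hoo Koo pZ pX _ pS SX SS R0 Rate.
have mH : mxmeasurable H by move=> i j; split.
have mfrob := measurable_frob2 mH.
pose B p y := (\int[k y]_w (capacity (SX p) SZ (H w))%:E)%E.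
pose G p y := (\int[k y]_w (gap (SX p) (SS p) SZ (H w))%:E)%E.
have G0 := mean_gap_cvg0 mH rk Hoo Koo pZ pX pS.
(* Convergence to 0 makes the mean loss finite at high power, which gives the integrability of [G p]
   used below. *)
have Gfin : \forall p \near +oo, (\int[mu]_y G p y)%E \is a fin_num.
  by case/fine_cvgP: G0.
have [c c0 capP] := capacity_bound pX pZ.
(* [rate_sandwich] needs a finite conditional second moment, available for almost every [y]. *)
have frob_fin : {ae mu, forall y, (\int[k y]_w (frob2 (H w))%:E < +oo)%E}.
  have iF : mu.-integrable setT (fun y => \int[k y]_w (frob2 (H w))%:E)%E.
    have frob0 w : 0 <= frob2 (H w) by exact: frob2_ge0.
    apply: integrable_ge0 Hoo; first exact: measurable_kernel_integral.
    by move=> y; exact: EFin_integral_ge0.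
  apply: filterS (integrable_ae measurableT iF) => y /(_ I).
  by rewrite fin_numElt => /andP[].
(* The loss is squeezed between 0 and the mean loss of [W = 1]. *)
apply: (@squeeze_cvge _ _ _ _ (cst 0)%E _ (fun p => \int[mu]_y G p y)%E) => //;
  last exact: cvg_cst.
near=> p.
have p0 : 0 < p by [].
have pX' : pdmx (SX p) by exact: pdmxZ.
have pS' : psdmx (SS p) by apply: psdmxZ => //; exact: ltW.
have mcap := measurable_capacity (SX p) SZ mH.
have mgap := measurable_gap (SX p) (SS p) SZ mH.
have cap0 w : 0 <= capacity (SX p) SZ (H w) by have /andP[] := capP (H w) p p0.
have gap0 w : 0 <= gap (SX p) (SS p) SZ (H w) by exact: gap_ge0.
have Bge0 y : (0 <= B p y)%E by exact: EFin_integral_ge0.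
have Gge0 y : (0 <= G p y)%E by exact: EFin_integral_ge0.
have iB : mu.-integrable setT (B p).
  apply: integrable_ge0 Bge0 _; first exact: measurable_kernel_integral.
  have pc0 := mulr_ge0 (ltW p0) c0.
  have := kernel_integral_ltyZ mfrob pc0 (fun w => frob2_ge0 (H w)) Hoo.
  apply: le_lt_trans; apply: ae_le_integralT; apply: aeW => y.
  apply: ae_le_integralT; apply: aeW => w; rewrite lee_fin.
  by have /andP[] := capP (H w) p p0.
have Gp : (\int[mu]_y G p y)%E \is a fin_num by near: p.
have iG : mu.-integrable setT (G p).
  apply: integrable_ge0 Gge0 _; first exact: measurable_kernel_integral.
  by move: Gp; rewrite fin_numElt => /andP[].
have Bp : (\int[mu]_y B p y)%E \is a fin_num by exact: integral_fune_fin_num.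
have R0E : R0 p = (\int[mu]_y B p y)%E by [].
have sandwich := fun y => @rate_sandwich _ _ _ _ _ (k y) H SZ SX' SS' p p0 (prob_kernel y)
  mH pZ pX pS.
have up : (Rate p <= \int[mu]_y B p y)%E.
  by apply: ae_le_integralT; apply: filterS frob_fin => y /sandwich /andP[].
have down : (\int[mu]_y B p y - \int[mu]_y G p y <= Rate p)%E.
  rewrite -integralB //.
  by apply: ae_le_integralT; apply: filterS frob_fin => y /sandwich /andP[].
(* Finiteness allows [Rate p] to be moved across the extended-real inequalities. *)
have Rfin : Rate p \is a fin_num.
  rewrite fin_numElt; apply/andP; split.
    by apply: lt_le_trans down; rewrite -(fineK Bp) -(fineK Gp) ltNyr.
  by apply: le_lt_trans up _; rewrite -(fineK Bp) ltry.
rewrite R0E sube_ge0 ?Rfin ?orbT // up leeBlDr // addeC -leeBlDr //.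
Unshelve. all: by end_near. Qed.
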